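(* Let $l \ge 0$ and $p_1 \geq p_2 \geq \cdots \geq p_m \geq 1$ be integers, let $V = V' \sqcup P_1 \sqcup \cdots \sqcup P_m$ with $|V'|=l$, $|P_i|=p_i$, $n = |V|$, and let $\Lambda$ be the simplicial complex on $V$ whose faces are the subsets of $V$ containing no $P_i$. Let $S = S(\infty^{n-d-m}, p_1-1, \ldots, p_m-1)$ and let $S^d$ be the set of elements of $S$ of degree at most $d$. Let $O$ be a total ordering $y_1 < y_2 < \cdots < y_n$ of $V$ such that $y_{n-m+i} \in P_i$ for $1 \leq i \leq m$, and let $1 \leq d \leq n-m$. Then there exist an ordering $L = (\tau_1, \ldots, \tau_t)$ of the facets of $\mathrm{skel}_d(\Lambda)$ (which is a shelling) and a bijection $\sigma$ from the set of facets of $\mathrm{skel}_d(\Lambda)$ to $S^d$ such that for every $i$: (1) $\overline{\tau_i} \setminus \bigcup_{j<i}\overline{\tau_j} = \{\gamma \subseteq \tau_i : R_O(\tau_i) \subseteq \gamma\}$; (2) $\deg(\sigma(\tau_i)) = |T_L(\tau_i)|$; (3) if $\gamma \in T_L(\tau_i)$, then there exist $j < i$ and a divisor $\mu$ of $\sigma(\tau_i)$ such that $\gamma \subseteq \tau_j$, $\deg(\mu) = \deg(\sigma(\tau_j))$, and $\sigma(\tau_j) \leq \mu$.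
   Context: If $p_i = 1$ the set $P_i$ contributes as in the definition; in $S(a_1,\ldots,a_k)$ a variable with $a_i = 0$ is simply dropped. $S(a_1,\ldots,a_k)$ ($0\le a_i\le\infty$) is the set of monomials $x_1^{c_1}\cdots x_k^{c_k}$ with $c_i\le a_i$; $S(\infty^r,a_{r+1},\ldots,a_k)$ means $a_1=\cdots=a_r=\infty$. $\mathrm{skel}_d(\Lambda)$ denotes the $(d-1)$-skeleton of $\Lambda$ (faces of size at most $d$); its facets are the $d$-element subsets of $V$ containing no $P_i$. For a set $\tau$, $\overline{\tau}$ is the set of all subsets of $\tau$. For an ordering $L=(\tau_1,\ldots,\tau_t)$ of facets, $T_L(\tau_1)=\emptyset$ and for $i>1$, $T_L(\tau_i)$ is the set of facets (maximal faces) of the complex $\overline{\tau_i}\cap\bigcup_{j<i}\overline{\tau_j}$. For monomials $\mu = x_1^{c_1}\cdots x_k^{c_k}$ and $\mu' = x_1^{e_1}\cdots x_k^{e_k}$ of equal degree, $\mu < \mu'$ if for some $i$, $c_i < e_i$ and $c_j = e_j$ for all $j>i$ (reverse lexicographic order); $\le$ means $<$ or $=$. For a face $\tau$ of $\Lambda$: $full(\tau) = \{i : |P_i \cap \tau| = |P_i| - 1\}$; for $i \in full(\tau)$, $miss(\tau,i)$ is the unique element of $P_i$ not in $\tau$; $s_O(\tau)$ is the $O$-first element of $V \setminus \{miss(\tau,i) : i\in full(\tau)\}$ not in $\tau$, or $\infty$ if none exists; $\tau_{>s_O(\tau)} = \{y \in \tau : y > s_O(\tau)\}$; $U_O(\tau)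 = \{y : y \in P_i \text{ and } y > miss(\tau,i) \text{ for some } i \in full(\tau)\}$; and $R_O(\tau) = \tau_{>s_O(\tau)} \cup U_O(\tau)$. *)

(* Defs.v *)
(* MathComp, with the monomials 'X_{1..k} of the multinomials library. *)
From mathcomp Require Export all_boot.
From mathcomp Require Export mpoly.

Set Implicit Arguments.
Unset Strict Implicit.
Unset Printing Implicit Defensive.

(** * Simplicial complexes on a finite vertex set *)

Section Complexes.
Variable V : finType.
Implicit Types (K : {set {set V}}) (tau : {set V}).

(* [facets set0 = set0], whereas [facets [set set0] = [set set0]]: the complex
   without faces is distinguished from the one whose only face is empty. *)
Definition facets K : {set {set V}} := [set tau | maxset (fun F => F \in K) tau].

(* Faces of size at most d, i.e. of dimension at most d - 1. *)
Definition skel (d : nat) K : {set {set V}} := [set tau in K | #|tau| <= d].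

(* The complex generated by the facets strictly before position i;
   [powerset tau] is the complex of all subsets of tau. *)
Definition before t (L : t.-tuple {set V}) (i : 'I_t) : {set {set V}} :=
  \bigcup_(j < t | j < i) powerset (tnth L j).

(* At the first position [before L i] has no face at all, so T_L L i = set0. *)
Definition T_L t (L : t.-tuple {set V}) (i : 'I_t) : {set {set V}} :=
  facets (powerset (tnth L i) :&: before L i).

Definition is_facet_ordering K t (L : t.-tuple {set V}) : Prop :=
  uniq L /\ L =i facets K.

(* Each facet meets the union of the previous ones in a complex that is pure
   of codimension one; nothing is required of the first facet. *)
Definition is_shelling K t (L : t.-tuple {set V}) : Prop :=
  is_facet_ordering K L /\
  forall i gamma, gamma \in T_L L i -> #|gamma|.+1 = #|tnth L i|.

End Complexes.

(** * The complex Lambda and the restriction sets R_O *)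

Section Restriction.
Variables (V : finType) (m : nat) (P : 'I_m -> {set V}).

Definition Lambda : {set {set V}} :=
  [set tau : {set V} | [forall i, ~~ (P i \subset tau)]].

(* Written without truncated subtraction: #|P i :&: tau| = #|P i| - 1. *)
Definition full (tau : {set V}) : {set 'I_m} :=
  [set i | #|P i :&: tau|.+1 == #|P i|].

(* For i in full tau, P i :\: tau is a singleton {x}, and miss is Some x. *)
Definition miss (tau : {set V}) (i : 'I_m) : option V := [pick x in P i :\: tau].

Definition missing (tau : {set V}) : {set V} :=
  [set x | [exists i in full tau, miss tau i == Some x]].

(* A total order on V is given by its increasing list of elements O. *)
Variable O : seq V.

(* y > x in the order O, where x = None stands for infinity. *)
Definition gtO (y : V) (x : option V) : bool :=
  if x is Some z then index z O < index y O else false.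

Definition s_O (tau : {set V}) : option V :=
  ohead [seq x <- O | (x \notin missing tau) && (x \notin tau)].

Definition U_O (tau : {set V}) : {set V} :=
  [set y | [exists i in full tau, (y \in P i) && gtO y (miss tau i)]].

Definition R_O (tau : {set V}) : {set V} :=
  [set y in tau | gtO y (s_O tau)] :|: U_O tau.

End Restriction.

(** * Monomials with bounded exponents *)

(* The monomials of S(a_1, ..., a_k), where None is the bound infinity; a
   variable with bound 0 is kept but only occurs with exponent 0. *)
Definition Smon k (a : 'I_k -> option nat) : {pred 'X_{1..k}} :=
  fun c => [forall i, if a i is Some b then c i <= b else true].

Definition Smon_deg k (a : 'I_k -> option nat) (d : nat) : {pred 'X_{1..k}} :=
  fun c => (c \in Smon a) && (mdeg c <= d).

(* (infinity^r, p_1 - 1, ..., p_m - 1) *)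
Definition bounds r m (p : 'I_m -> nat) : 'I_(r + m) -> option nat :=
  fun i => match split i with
           | inl _ => None
           | inr j => Some (p j).-1
           end.
Arguments bounds r {m} p _.

(* Meant for monomials of equal degree. The last variable is the most
   significant one, unlike in the order mpoly declares on 'X_{1..k}. *)
Definition revlex_lt k (c e : 'X_{1..k}) : Prop :=
  exists i : 'I_k, c i < e i /\ forall j : 'I_k, i < j -> c j = e j.

Definition revlex_le k (c e : 'X_{1..k}) : Prop := revlex_lt c e \/ c = e.

Definition bijection_between (A B : eqType) (D : {pred A}) (E : {pred B})
    (f : A -> B) : Prop :=
  [/\ forall x, x \in D -> f x \in E,
      {in D &, injective f} &
      forall y, y \in E -> exists2 x, x \in D & f x = y].

(* Main.v *)
(* For a face t let w_i be the last element of P i outside t. The elements of P i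
   after the w_i number at most p_i - 1 and are the exponents of the last m
   variables of sigma t. What is left of V once all P i are cut off at w_i is the
   pool of t; t misses exactly n - d - m elements of it, the gaps, and can be
   any d - (sum of the previous exponents) elements of it. The numbers of elements
   of t in the pool between consecutive gaps are the exponents of the first
   variables. So sigma is a bijection onto S^d, and R_O t consists of all elements
   of t beyond some w_i in P i or beyond the first gap, that is of the elements
   counted by sigma t.
   The facets are ordered by their largest differing element. If y is in R_O t,
   replacing it by w_i, respectively by a gap before y, gives an earlier facet with
   no larger restriction and with a smaller monomial; a pigeonhole argument shows
   that the other facets containing R_O t come later. *)
Require Import Defs.
From mathcomp Require Import zify.
Set Implicit Arguments.
Unset Strict Implicit.
Unset Printing Implicit Defensive.

(** * Divisors in the reverse lexicographic order *)

Section Monomials.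
Variable k : nat.
Implicit Types c e mu : 'X_{1..k}.

(** While the degree of [e] exceeds [D], some exponent of [e] is above that of [c] and can be
    lowered by one. *)
Lemma lepm_mdeg_interpolation c e D :
  (c <= e)%MM -> mdeg c <= D <= mdeg e ->
  exists mu, [/\ (c <= mu)%MM, (mu <= e)%MM & mdeg mu = D].
Proof.
move=> le_ce /andP[le_cD]; move: {-2}(mdeg e) (erefl (mdeg e)) => s.
elim: s e le_ce => [|s IHs] e le_ce deg_e le_De.
  by exists e; rewrite lepm_refl; split=> //; lia.
have [<-|ne_D] := eqVneq (mdeg e) D; first by exists e; rewrite lepm_refl.
have [i lt_i]: exists i, c i < e i.
  apply/existsP; apply: contraT => /existsPn le_ec.
  suff: mdeg e <= mdeg c by lia.
  by rewrite !mdegE leq_sum // => i _; rewrite leqNgt.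
have le_Ue: (U_(i) <= e)%MM by rewrite lep1mP; lia.
have deg_eU: mdeg (e - U_(i))%MM = s.
  have := congr1 mdeg (submK le_Ue); rewrite mdegD mdeg1; lia.
have le_ceU: (c <= e - U_(i))%MM.
  apply/mnm_lepP=> j; rewrite mnmBE mnm1E; have /mnm_lepP/(_ j) := le_ce.
  by case: eqP => [<-|_]; lia.
have [|mu [le_cmu le_mue deg_mu]] := IHs _ le_ceU (esym deg_eU); first by lia.
exists mu; split=> //; apply: lepm_trans le_mue _.
by apply/mnm_lepP=> j; rewrite mnmBE leq_subr.
Qed.

(** This reduces claim (3) to exchanges that lower the monomial strictly without raising the degree
    of the earlier one above that of the later. *)
Lemma revlex_lt_divisor c e :
  revlex_lt c e -> mdeg c <= mdeg e ->
  exists mu, [/\ (mu <= e)%MM, mdeg mu = mdeg c & revlex_le c mu].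
Proof.
case=> i [lt_i eq_above] le_deg.
(* If c is not nu 0 then it has larger degree, and any mu between nu 1 and e is
   above c. *)
pose nu b := [multinom if i < j then e j else if j == i then c i + b else 0 | j < k].
have nu0_le_c : (nu 0%N <= c)%MM.
  apply/mnm_lepP=> j; rewrite mnmE; case: ifP => [/eq_above->//|_].
  by case: eqP => [->|//]; rewrite addn0.
have nu1_le_e : (nu 1%N <= e)%MM.
  apply/mnm_lepP=> j; rewrite mnmE; case: ifP => // _.
  by case: eqP => [->|//]; rewrite addn1.
have nu1E : nu 1%N = (nu 0%N + U_(i))%MM.
  apply/mnmP=> j; rewrite mnmDE mnm1E !mnmE [i == j]eq_sym.
  by case: (eqVneq j i) => [->|_]; rewrite ?ltnn ?addn0.
have [deg_c|/eqP ne_deg] := eqVneq (mdeg c) (mdeg (nu 0%N)).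
  exists c; split=> //; last by right.
  apply/mnm_lepP=> j; have [lt_ij|lt_ji|/val_inj <-] := ltngtP i j.
  - by rewrite eq_above.
  - have := deg_c; rewrite -{1}(submK nu0_le_c) mdegD => deg0.
    have /eqP : mdeg (c - nu 0%N)%MM = 0 by lia.
    rewrite mdeg_eq0 => /eqP /mnmP/(_ j); rewrite mnmBE mnm0E mnmE.
    by rewrite ltnNge ltnW //= -val_eqE ltn_eqF //; lia.
  - exact: ltnW.
have le_nu1 : mdeg (nu 1%N) <= mdeg c.
  have := congr1 mdeg (submK nu0_le_c); rewrite nu1E !mdegD mdeg1; lia.
have [|mu [/mnm_lepP le_nu_mu le_mu_e deg_mu]] :=
  lepm_mdeg_interpolation (D := mdeg c) nu1_le_e; first by rewrite le_nu1.
exists mu; split=> //; left; exists i; split.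
  by have := le_nu_mu i; rewrite mnmE ltnn eqxx addn1.
move=> j lt_ij; have := le_nu_mu j; have /mnm_lepP/(_ j) := le_mu_e.
by rewrite mnmE lt_ij eq_above //; lia.
Qed.

End Monomials.

(** * Sets with an injective rank *)

(** Any choice of a related [y] for each [x] is an injection. *)
Lemma leq_card_rel (T T' : finType) (A : {pred T}) (B : {pred T'})
    (r : T -> T' -> bool) :
    {in A, forall x, exists2 y, y \in B & r x y} ->
    {in A &, forall x x', forall y, r x y -> r x' y -> x = x'} ->
  #|A| <= #|B|.
Proof.
move=> exr r_inj; case: (pickP (mem A)) => [x0 Ax0|A0]; last by rewrite eq_card0.
have [y0 _ _] := exr x0 Ax0.
pose f x := odflt y0 [pick y in B | r x y].
have fP x : x \in A -> f x \in B /\ r x (f x).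
  move=> Ax; rewrite /f; case: pickP => [y /andP[]//|/= r0].
  by have [y By rxy] := exr x Ax; have := r0 y; rewrite By rxy.
rewrite -(card_in_image (f := f)) => [|x x' Ax Ax' eqf].
  by apply/subset_leq_card/subsetP=> _ /imageP[x Ax ->]; case: (fP x Ax).
have [_ rx] := fP x Ax; have [_] := fP x' Ax'; rewrite -eqf.
exact: r_inj rx.
Qed.

(** Each [y] with positive [g y] is counted for exactly one [j], namely [g y - 1]. *)
Lemma sum_card_eqS (T : finType) (A : {set T}) (g : T -> nat) r :
  {in A, forall y, g y <= r} ->
  \sum_(j < r) #|[set y in A | g y == j.+1]| = #|[set y in A | 0 < g y]|.
Proof.
move=> le_gr; under eq_bigr => j _ do rewrite -sum1dep_card big_mkcondr.
rewrite exchange_big -sum1dep_card big_mkcondr; apply: eq_bigr => y Ay /=.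
rewrite -big_mkcond; case: ifPn => [g_gt0|g0]; last first.
  by rewrite big_pred0 // => j; apply: contraNF g0 => /eqP->.
have lt_gr : (g y).-1 < r by have := le_gr y Ay; lia.
rewrite (big_pred1 (Ordinal lt_gr)) // => j.
by rewrite /= -val_eqE /=; apply/eqP/eqP; lia.
Qed.

Section RankedSets.
Variables (V : finType) (rk : V -> nat).
Hypothesis rk_inj : injective rk.
Implicit Types A B G W : {set V}.

(** * Comparing sets by their largest differing element *)

Lemma top_difference A B :
  A != B -> exists z, (z \in A) != (z \in B) /\
                      forall y, rk z < rk y -> (y \in A) = (y \in B).
Proof.
move=> neqAB; have [z0 z0P]: exists z, (z \in A) != (z \in B).
  apply/existsP; apply: contraNT neqAB => /existsPn eqAB.
  by apply/eqP/setP=> z; apply/eqP/negPn.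
case: (@arg_maxnP _ z0 (fun z => (z \in A) != (z \in B)) rk z0P) => z zP z_max.
exists z; split=> // y lt_zy; apply/eqP; apply: contraTT lt_zy => /z_max.
by rewrite -leqNgt.
Qed.

(** A binary number with the membership of [y] as digit at [rk y]; as [rk] is injective, comparing
    keys is the colexicographic order. *)
Definition key A := \sum_(y in A) 2 ^ rk y.

Lemma key_ltn_exp A k : {in A, forall y, rk y < k} -> key A < 2 ^ k.
Proof.
elim: k A => [|k IHk] A ltA.
  by rewrite /key big_pred0 // => y; apply/negP => /ltA.
rewrite expnS mul2n -addnn; case: (pickP [pred y in A | rk y == k]) => [y|no_k].
  case/andP=> Ay /eqP rk_y; rewrite /key (big_setD1 y) //= rk_y -addnS leq_add2l.
  apply: IHk => x; rewrite in_setD1 => /andP[ne_xy /ltA].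
  by rewrite ltnS leq_eqVlt -rk_y => /predU1P[/rk_inj/eqP|//]; rewrite (negPf ne_xy).
rewrite (leq_trans (IHk _ _)) ?leq_addl // => y Ay.
by have := ltA y Ay; have := no_k y; rewrite inE Ay /= ltnS leq_eqVlt => ->.
Qed.

(** Elements above [z] contribute equally; the rest of [A] lies strictly below [z] and sums to less
    than the single term [2 ^ rk z] of [B]. *)
Lemma ltn_key A B z :
  z \in B -> z \notin A -> (forall y, rk z < rk y -> (y \in A) = (y \in B)) ->
  key A < key B.
Proof.
move=> Bz Az eqAB; rewrite /key (bigID (fun y => rk z < rk y)) /=.
rewrite [X in _ < X](bigID (fun y => rk z < rk y)) /=.
rewrite (eq_bigl (fun y => (y \in B) && (rk z < rk y))); last first.
  by move=> y; case: (ltnP (rk z) (rk y)) => [/eqAB->|]; rewrite ?andbF.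
rewrite ltn_add2l [X in _ < X](bigD1 z) /=; last by rewrite Bz ltnn.
apply: leq_trans (leq_addr _ _).
rewrite (eq_bigl (mem [set y in A | ~~ (rk z < rk y)])) => [|y]; last by rewrite /= inE.
apply: key_ltn_exp => y.
rewrite inE -leqNgt leq_eqVlt => /andP[Ay /predU1P[/rk_inj eq_yz|//]].
by rewrite -eq_yz Ay in Az.
Qed.

Lemma key_exchange A x y :
  y \in A -> x \notin A -> rk x < rk y -> key (x |: A :\ y) < key A.
Proof.
move=> Ay Ax lt_xy; apply: (ltn_key (z := y)) => //.
  by rewrite !inE eqxx orbF; apply: contraTneq Ay => ->.
move=> z; rewrite !inE; have [->|_] := eqVneq z x; first by lia.
by have [->|//] := eqVneq z y; rewrite ltnn.
Qed.

(** * Numbers of elements between consecutive gaps *)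

Definition below G y : {set V} := [set z in G | rk z < rk y].

(* The number of elements of W :\: G lying between the j-th and the next
   element of G, counted from 0; those before the first one are not counted. *)
Definition gap_count W G j := #|[set y in W :\: G | #|below G y| == j.+1]|.

Lemma card_below G y : #|below G y| + #|[set z in G | rk y <= rk z]| = #|G|.
Proof.
rewrite -(cardsID [set z | rk z < rk y] G); congr (_ + _); apply: eq_card => z.
  by rewrite !inE.
by rewrite !inE -leqNgt andbC.
Qed.

Lemma below_subset G y z : rk y <= rk z -> below G y \subset below G z.
Proof.
by move=> le_yz; apply/subsetP=> x; rewrite !inE => /andP[->] /= /leq_trans->.
Qed.

Lemma sum_gap_count W G r :
  #|G| = r ->
  \sum_(j < r) gap_count W G j = #|[set y in W :\: G | 0 < #|below G y|]|.
Proof.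
move=> <-; apply: sum_card_eqS => y _; apply: subset_leq_card.
by apply/subsetP=> z; rewrite inE => /andP[].
Qed.

(** Counting from above shows that at points beyond [z] both sets have equally many elements below,
    while at [z] the set [G] has one more than [G']. So for [k] the number of elements of [G'] below
    [z], the counts agree after [k], and at [k] the set [G] counts at least [z] in addition. *)
Lemma gap_count_revlex W G G' z :
    #|G| = #|G'| -> z \in W -> z \in G' -> z \notin G ->
    (forall y, rk z < rk y -> (y \in G') = (y \in G)) ->
  exists k, [/\ k < #|G'|, gap_count W G' k < gap_count W G k &
                forall j, k < j -> gap_count W G' j = gap_count W G j].
Proof.
move=> eqG Wz G'z Gz agree; exists #|below G' z|.
have card_above y : rk z < rk y ->
    #|[set x in G | rk y <= rk x]| = #|[set x in G' | rk y <= rk x]|.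
  move=> lt_zy; apply: eq_card => x; rewrite !inE.
  by case: (leqP (rk y) (rk x)) => [le_yx|]; rewrite ?andbF // agree //; lia.
have eq_below y : rk z < rk y -> #|below G y| = #|below G' y|.
  move=> lt_zy; have := card_below G y; have := card_below G' y.
  by rewrite (card_above y) //; lia.
have below_z : #|below G z| = #|below G' z|.+1.
  have := card_below G z; have := card_below G' z.
  suff -> : [set x in G' | rk z <= rk x] = z |: [set x in G | rk z <= rk x].
    by rewrite cardsU1 !inE (negPf Gz) /=; lia.
  apply/setP=> x; rewrite !inE; have [->|ne_xz] := eqVneq x z.
    by rewrite G'z leqnn.
  rewrite leq_eqVlt; have [/rk_inj eq_zx|_] := eqVneq (rk z) (rk x).
    by rewrite eq_zx eqxx in ne_xz.
  by case: (ltnP (rk z) (rk x)) => [/agree->|]; rewrite ?andbF.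
have lt_z y G1 : #|below G1 z| < #|below G1 y| -> rk z < rk y.
  by rewrite !ltnNge; apply: contra => /below_subset-/(_ G1)/subset_leq_card.
split.
- rewrite -(card_below G' z) -[X in X < _]addn0 ltn_add2l card_gt0.
  by apply/set0Pn; exists z; rewrite inE G'z leqnn.
- apply: proper_card; apply/properP; split; last first.
    by exists z; rewrite !inE ?G'z // Gz Wz below_z eqxx.
  apply/subsetP=> y; rewrite !inE => /andP[/andP[G'y ->] /eqP def_j].
  have lt_zy : rk z < rk y by apply: (lt_z y G'); rewrite def_j.
  by rewrite -agree // G'y eq_below // def_j eqxx.
move=> j lt_kj; apply: eq_card => y; rewrite !inE.
have [le_yz|lt_zy] := leqP (rk y) (rk z); last by rewrite agree // eq_below.
have := subset_leq_card (below_subset G le_yz).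
have := subset_leq_card (below_subset G' le_yz); rewrite below_z => le1 le2.
have /negPf -> : #|below G y| != j.+1 by apply/eqP; lia.
by have /negPf -> : #|below G' y| != j.+1 by [apply/eqP; lia]; rewrite !andbF.
Qed.

Lemma gap_count_inj W G G' :
    G \subset W -> G' \subset W -> #|G| = #|G'| ->
    (forall j, j < #|G| -> gap_count W G j = gap_count W G' j) ->
  G = G'.
Proof.
move=> sGW sG'W eqG eq_count; apply/eqP; apply: contraT => /top_difference[z []].
case: (boolP (z \in G)) => Gz; case: (boolP (z \in G')) => //= G'z _ agree.
  have [j [lt_j]] := gap_count_revlex (esym eqG) (subsetP sGW z Gz) Gz G'z agree.
  by rewrite eq_count // ltnn.
have agree' y : rk z < rk y -> (y \in G') = (y \in G) by move/agree->.
have [j [lt_j]] := gap_count_revlex eqG (subsetP sG'W z G'z) G'z Gz agree'.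
by rewrite eq_count ?eqG // ltnn.
Qed.

(* By injectivity, since both sides number 'C(r + D, r). *)
Lemma gap_count_surj W r D (c : 'I_r -> nat) :
    #|W| = r + D -> \sum_j c j <= D ->
  exists2 G : {set V}, G \subset W /\ #|G| = r & forall j : 'I_r, gap_count W G j = c j.
Proof.
move=> card_W le_cD.
pose A := [set G : {set V} | (G \subset W) && (#|G| == r)].
(* [inord] loses nothing on [A]: the counts sum to at most [D], since [W :\: G] has [D] elements. *)
pose f (G : {set V}) := [tuple (inord (gap_count W G j) : 'I_D.+1) | j < r].
pose B := [set t : r.-tuple 'I_D.+1 | \sum_(i <- t) i <= D].
have sum_le G : G \in A -> \sum_(j < r) gap_count W G j <= D.
  rewrite inE => /andP[sGW /eqP card_G]; rewrite (sum_gap_count W card_G).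
  have -> : D = #|W :\: G| by rewrite cardsDS // card_W card_G; lia.
  by apply: subset_leq_card; apply/subsetP=> y; rewrite inE => /andP[].
have le_sum (F : 'I_r -> nat) (j : 'I_r) : F j <= \sum_i F i.
  by rewrite (bigD1 j) //= leq_addr.
have fE G j : G \in A -> tnth (f G) j = gap_count W G j :> nat.
  move=> AG; rewrite tnth_mktuple inordK // ltnS.
  exact: leq_trans (le_sum (fun j => gap_count W G j) j) (sum_le G AG).
have f_inj : {in A &, injective f}.
  move=> G G' AG AG' eqf; have := AG; have := AG'; rewrite !inE.
  case/andP=> sG'W /eqP card_G' /andP[sGW /eqP card_G].
  apply: (gap_count_inj sGW sG'W) => [|j]; first by rewrite card_G.
  by rewrite card_G => lt_jr; rewrite -(fE G (Ordinal lt_jr)) // eqf fE.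
have fA : f @: A = B.
  apply/eqP; rewrite eqEcard card_in_imset // card_partial_ord_partitions.
  rewrite cards_draws card_W leqnn andbT; apply/subsetP=> _ /imsetP[G AG ->].
  by rewrite inE big_tuple; under eq_bigr => j _ do rewrite fE //; exact: sum_le.
have cB : [tuple (inord (c j) : 'I_D.+1) | j < r] \in B.
  rewrite inE big_tuple; under eq_bigr => j _.
    by rewrite tnth_mktuple inordK ?ltnS ?(leq_trans (le_sum c j)) //; over.
  by [].
have := cB; rewrite -fA => /imsetP[G AG def_c]; exists G.
  by move: AG; rewrite inE => /andP[? /eqP].
move=> j; rewrite -(fE G j AG) -def_c tnth_mktuple inordK // ltnS.
exact: leq_trans (le_sum c j) le_cD.
Qed.

(** * Final segments of a ranked set *)

Definition upclosed_in A B := forall x y, x \in B -> y \in A -> rk x <= rk y -> y \in B.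

(** If [x] is in [B] but not in [B'], then all of [B'] lies above [x], hence strictly inside [B]. *)
Lemma upclosed_in_subset A B B' :
  B \subset A -> B' \subset A -> upclosed_in A B -> upclosed_in A B' ->
  #|B| <= #|B'| -> B \subset B'.
Proof.
move=> sBA sB'A upB upB' leB; apply/subsetP=> x Bx; apply: contraT => B'x.
suff: #|B'| < #|B| by lia.
apply: proper_card; apply/properP; split; last by exists x.
apply/subsetP=> y B'y; apply: (upB x) => //; first exact: (subsetP sB'A).
rewrite leqNgt; apply: contra B'x => /ltnW le_yx.
by apply: (upB' y); rewrite ?(subsetP sBA).
Qed.

Lemma upclosed_in_exists A k :
  k <= #|A| -> exists2 B : {set V}, B \subset A /\ #|B| = k & upclosed_in A B.
Proof.
elim: k => [|k IHk] lt_k.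
  by exists set0; [rewrite sub0set cards0 | move=> x y; rewrite inE].
have [B [sBA card_B] upB] := IHk (ltnW lt_k).
have [x0 x0P]: exists x, x \in A :\: B.
  by apply/set0Pn; rewrite -card_gt0 cardsDS // card_B subn_gt0.
case: (@arg_maxnP _ x0 (fun x => x \in A :\: B) rk x0P) => x.
rewrite inE => /andP[Bx Ax] x_max.
exists (x |: B).
  by rewrite cardsU1 Bx card_B subUset sub1set Ax.
move=> y z; rewrite !inE => yP Az le_yz; apply/orP.
case: (boolP (z \in B)) => [|Bz]; first by right.
left; apply/eqP/rk_inj; have le_zx : rk z <= rk x by apply: x_max; rewrite inE Bz.
case/predU1P: yP => [eq_yx|By]; first by apply/eqP; rewrite eqn_leq le_zx -eq_yx.
by rewrite (upB y z) in Bz.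
Qed.

End RankedSets.

(** * The faces of Lambda and their monomials *)

Section Facets.
Variables (V : finType) (m : nat) (P : 'I_m -> {set V}) (rk : V -> nat).
Hypothesis rk_inj : injective rk.
Hypothesis disj_P : forall i j, i != j -> [disjoint P i & P j].
Implicit Types (t : {set V}) (i : 'I_m).

Lemma P_index i j y : y \in P i -> y \in P j -> i = j.
Proof.
move=> Piy Pjy; apply/eqP; apply: contraT => /disj_P/pred0P/(_ y) /=.
by rewrite Piy Pjy.
Qed.

(* The part of P i from the last element of P i missing from t onwards. *)
Definition tail t i : {set V} :=
  [set y in P i | [set z in P i | rk y < rk z] \subset t].

Definition pool t : {set V} := ~: \bigcup_i tail t i.

Definition gaps t : {set V} := pool t :\: t.

(** For a face, intersecting with [t] removes from each tail its first element, the last one of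
    [P i] missing from [t]; the other set is everything beyond the first gap. [R_O_restr] identifies
    this with [R_O]. *)
Definition restr t : {set V} :=
  t :&: (\bigcup_i tail t i :|: [set y | 0 < #|below rk (gaps t) y|]).

Lemma tailP t i y :
  reflect (y \in P i /\ forall z, z \in P i -> rk y < rk z -> z \in t) (y \in tail t i).
Proof.
rewrite inE; apply: (iffP andP) => -[Piy]; last first.
  by move=> in_t; split=> //; apply/subsetP=> z; rewrite inE => /andP[]; exact: in_t.
by move/subsetP=> in_t; split=> // z Piz lt_yz; apply: in_t; rewrite inE Piz.
Qed.

Lemma tail_subset t i : tail t i \subset P i.
Proof. by apply/subsetP=> y /tailP[]. Qed.

Lemma tail_upclosed t i : upclosed_in rk (P i) (tail t i).
Proof.
move=> x y /tailP[_ in_t] Piy le_xy; apply/tailP; split=> // z Piz lt_yz.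
by apply: in_t => //; apply: leq_ltn_trans lt_yz.
Qed.

Lemma poolE t y : (y \in pool t) = (y \notin \bigcup_i tail t i).
Proof. exact: in_setC. Qed.

Lemma poolP t y : reflect (forall i, y \notin tail t i) (y \in pool t).
Proof.
rewrite inE; apply: (iffP idP) => [|notin_tail].
  by move/bigcupP=> notin_tail i; apply/negP=> tail_y; apply: notin_tail; exists i.
by apply/bigcupP=> -[i _]; apply/negP.
Qed.

Lemma below_gt0P (G : {set V}) y :
  reflect (exists2 z, z \in G & rk z < rk y) (0 < #|below rk G y|).
Proof.
apply: (iffP card_gt0P) => -[z]; first by rewrite inE => /andP[]; exists z.
by move=> Gz lt_zy; exists z; rewrite inE Gz.
Qed.

Lemma restrP t y :
  reflect (y \in t /\ ((exists i, y \in tail t i) \/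
                       exists2 z, z \in gaps t & rk z < rk y))
          (y \in restr t).
Proof.
rewrite !inE; apply: (iffP andP) => -[ty].
  case/orP=> [/bigcupP[i _ tail_y]|/below_gt0P]; split=> //; last by right.
  by left; exists i.
case=> [[i tail_y]|/below_gt0P->]; rewrite ?orbT //.
by split=> //; apply/orP; left; apply/bigcupP; exists i.
Qed.

Lemma LambdaP t : reflect (forall i, exists2 x, x \in P i & x \notin t) (t \in Lambda P).
Proof.
rewrite inE; apply: (iffP forallP) => notP i; first exact/subsetPn.
by apply/subsetPn; apply: notP.
Qed.

Lemma last_missing t i : t \in Lambda P ->
  exists w, [/\ w \in P i, w \notin t &
             forall v, v \in P i -> (v \in tail t i) = (rk w <= rk v)].
Proof.
move=> /LambdaP/(_ i)[x0 Px0 tx0].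
have x0P : (x0 \in P i) && (x0 \notin t) by rewrite Px0.
case: (@arg_maxnP _ x0 (fun x => (x \in P i) && (x \notin t)) rk x0P) => w.
case/andP=> Pw tw w_max; exists w; split=> // v Pv.
apply/tailP/idP => [[_ in_t]|le_wv].
  by rewrite leqNgt; apply: contra tw => lt_vw; apply: in_t.
split=> // z Pz lt_vz; apply: contraT => tz.
have /= := w_max z; rewrite Pz tz /= => /(_ isT); lia.
Qed.

(** Only the first element of a tail is missing from the face, so the tail determines [t] on it;
    [sigma_inj] recovers [t] outside the pool in this way. *)
Lemma mem_tail_face t i y : t \in Lambda P -> y \in tail t i ->
  (y \in t) = [exists z in tail t i, rk z < rk y].
Proof.
move=> tL tail_y; have Py : y \in P i by apply: (subsetP (tail_subset t i)).
have [w [Pw tw tailE]] := last_missing i tL.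
apply/idP/existsP => [ty|[z /andP[/tailP[_ in_t] lt_zy]]]; last exact: in_t.
exists w; rewrite tailE // leqnn ltn_neqAle -tailE // tail_y andbT /=.
by apply: contraNneq tw => /rk_inj->.
Qed.

Lemma tail_missing t i w : w \in P i -> w \notin t ->
    (forall v, v \in P i -> (v \in tail t i) = (rk w <= rk v)) ->
  tail t i :\: t = [set w].
Proof.
move=> Pw tw tailE; apply/setP=> v; rewrite in_setD in_set1.
apply/andP/eqP=> [[tv tail_v]|->]; last by rewrite tailE // leqnn.
have Pv : v \in P i by apply: (subsetP (tail_subset t i)).
have := tail_v; rewrite tailE // leq_eqVlt => /predU1P[/rk_inj->//|lt_wv].
have : w \in tail t i by rewrite tailE.
by case/tailP=> _ /(_ v Pv lt_wv); rewrite (negPf tv).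
Qed.

Lemma tail_missingE t i x : t \in Lambda P -> x \in tail t i -> x \notin t ->
  tail t i :\: t = [set x].
Proof.
move=> tL tail_x tx; have [w [Pw tw tailE]] := last_missing i tL.
have := tail_missing Pw tw tailE => tailD; rewrite tailD.
by have : x \in tail t i :\: t by [rewrite inE tx]; rewrite tailD inE => /eqP->.
Qed.

Lemma card_tailD t i : t \in Lambda P -> #|tail t i :\: t| = 1.
Proof.
move=> tL; have [w [Pw tw tailE]] := last_missing i tL.
by rewrite (tail_missing Pw tw tailE) cards1.
Qed.

Lemma card_tail t i : t \in Lambda P -> #|tail t i :&: t| = #|tail t i|.-1.
Proof. by move=> tL; rewrite -(cardsID t (tail t i)) card_tailD // addn1. Qed.

Lemma card_tail_gt0 t i : t \in Lambda P -> 0 < #|tail t i|.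
Proof. by move=> tL; rewrite -(cardsID t (tail t i)) card_tailD // addn1. Qed.

Lemma card_bigcup_P (F : 'I_m -> {set V}) :
  (forall i, F i \subset P i) -> #|\bigcup_i F i| = \sum_i #|F i|.
Proof.
move=> sFP; rewrite -sum1_card partition_disjoint_bigcup /=.
  by apply: eq_bigr => i _; rewrite sum1_card.
by move=> i j /disj_P; apply: disjointW.
Qed.

(** Outside [t] lie the gaps and exactly one element of each of the [m] disjoint tails. *)
Lemma card_gaps t : t \in Lambda P -> #|gaps t| + m + #|t| = #|V|.
Proof.
move=> tL; rewrite addnC -(cardsC t); congr (_ + _).
rewrite -(cardsID (pool t) (~: t)); congr (_ + _).
  by apply: eq_card => y; rewrite !inE andbC.
have -> : ~: t :\: pool t = \bigcup_i (tail t i :\: t).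
  apply/setP=> y; rewrite in_setD poolE negbK in_setC andbC; apply/andP/bigcupP.
    move=> -[ty /bigcupP[i _ tail_y]].
    by exists i => //; rewrite inE ty.
  case=> i _; rewrite inE => /andP[ty tail_y]; split=> //.
  by apply/bigcupP; exists i.
rewrite card_bigcup_P => [|i]; last exact: subset_trans (subsetDl _ _) (tail_subset t i).
by under eq_bigr => i _ do rewrite card_tailD //; rewrite sum1_card card_ord.
Qed.

(** [r] stands for the number of gaps, the same for all facets by [card_gaps]. The predecessor
    discounts the missing element that starts the tail. *)
Definition sigma r t : 'X_{1..r + m} :=
  [multinom match split j with
            | inl j' => gap_count rk (pool t) (gaps t) j'
            | inr i => #|tail t i|.-1
            end | j < r + m].

Lemma sigma_lshift r t (j : 'I_r) :
  sigma r t (lshift m j) = gap_count rk (pool t) (gaps t) j.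
Proof. by rewrite mnmE (unsplitK (inl j)). Qed.

Lemma sigma_rshift r t i : sigma r t (rshift r i) = #|tail t i|.-1.
Proof. by rewrite mnmE (unsplitK (inr i)). Qed.

(** Elements of the restriction in a tail are counted by the last [m] exponents; the others are in
    the pool beyond the first gap and are counted by the first [r]. *)
Lemma mdeg_sigma r t : t \in Lambda P -> #|gaps t| = r ->
  mdeg (sigma r t) = #|restr t|.
Proof.
move=> tL card_G; rewrite mdegE big_split_ord /=.
under eq_bigr => j _ do rewrite sigma_lshift.
under [X in _ + X]eq_bigr => i _ do rewrite sigma_rshift -card_tail //.
rewrite sum_gap_count // -card_bigcup_P => [|i]; last first.
  exact: subset_trans (subsetIl _ _) (tail_subset t i).
rewrite addnC -(cardsID (\bigcup_i tail t i) (restr t)); congr (_ + _).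
  apply: eq_card => y; rewrite in_setI; apply/bigcupP/andP.
    case=> i _; rewrite inE => /andP[tail_y ty]; split; last by apply/bigcupP; exists i.
    by apply/restrP; split=> //; left; exists i.
  by case=> /restrP[ty _] /bigcupP[i _ tail_y]; exists i; rewrite // inE tail_y.
apply: eq_card => y; rewrite /restr /gaps /pool !inE.
by case: (y \in \bigcup_i _); case: (y \in t).
Qed.

(** The last [m] exponents fix the sizes of the tails, and final segments of equal size coincide; so
    the pools agree, and the first [r] exponents then determine the gaps. *)
Lemma sigma_inj r t t' :
    t \in Lambda P -> t' \in Lambda P -> #|gaps t| = r -> #|gaps t'| = r ->
  sigma r t = sigma r t' -> t = t'.
Proof.
move=> tL t'L card_G card_G' eq_sigma.
have eq_tail i : tail t i = tail t' i.
  have eq_card : #|tail t i| = #|tail t' i|.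
    have := congr1 (fun c : 'X_{1..r + m} => c (rshift r i)) eq_sigma.
    rewrite !sigma_rshift; have := card_tail_gt0 i tL; have := card_tail_gt0 i t'L.
    lia.
  by apply/eqP; rewrite eqEsubset; apply/andP; split;
     apply: (@upclosed_in_subset _ rk (P i));
     rewrite ?eq_card ?tail_subset //; exact: tail_upclosed.
have eq_pool : pool t = pool t' by congr (~: _); apply: eq_bigr => i _.
have eq_gaps : gaps t = gaps t'.
  apply: (@gap_count_inj _ rk rk_inj (pool t)) => [|||j].
  - exact: subsetDl.
  - by rewrite eq_pool; exact: subsetDl.
  - by rewrite card_G.
  rewrite card_G => lt_jr.
  have := congr1 (fun c : 'X_{1..r + m} => c (lshift m (Ordinal lt_jr))) eq_sigma.
  by rewrite !sigma_lshift /= -eq_pool.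
apply/setP=> y; case: (boolP (y \in pool t)) => [pool_y|].
  have : (y \in gaps t) = (y \in gaps t') by rewrite eq_gaps.
  by rewrite /gaps !in_setD -eq_pool pool_y !andbT => /negb_inj.
rewrite poolE negbK => /bigcupP[i _ tail_y].
by rewrite (mem_tail_face tL tail_y) (@mem_tail_face t' i) // -eq_tail.
Qed.

(** This shows that no earlier facet contains [restr t]. If the largest differing element [z] were
    in [t], it would be outside the restriction, so in no tail and before every gap of [t]; this
    forces [t'] to be smaller than [t]. *)
Lemma key_restr_lt t t' : t \in Lambda P -> t' \in Lambda P -> #|t| = #|t'| ->
  restr t \subset t' -> t != t' -> key rk t < key rk t'.
Proof.
move=> tL t'L eq_card /subsetP sRt' /(top_difference rk)[z []].
case: (boolP (z \in t)) => tz; case: (boolP (z \in t')) => //= t'z _ agree; last first.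
  exact: (ltn_key rk_inj t'z tz agree).
have restr_z : z \notin restr t by apply: contra t'z => /sRt'.
(* Otherwise t' loses, besides z, one element of t for each element it gains:
   the gained elements are the last missing elements of some P i. *)
suff : #|t' :\: t| <= #|(t :\: t') :\ z|.
  have := cardsD1 z (t :\: t'); rewrite inE tz t'z.
  have := cardsID t t'; have := cardsID t' t; rewrite setIC; lia.
have lt_z x : x \in t' :\: t -> rk x < rk z.
  rewrite inE ltn_neqAle => /andP[tx t'x]; apply/andP; split.
    by apply: contraNneq tx => /rk_inj->.
  by rewrite leqNgt; apply: contra tx => /agree->.
(* A gained [x] in the pool would be a gap of [t] before [z], putting [z] into the restriction. *)
have in_tail x : x \in t' :\: t -> exists i, x \in tail t i.
  move=> Dx; apply/existsP; apply: contraR restr_z => /existsPn /poolP pool_x.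
  apply/restrP; split=> //; right; exists x; last exact: lt_z.
  by move: Dx; rewrite !in_setD => /andP[-> _].
(* Match [x], the last element of [P i] missing from [t], with some [u] of [P i] missing from [t'].
   Were [u] also missing from [t], it would be a gap before [z]. Different [x] belong to different
   [P i]. *)
apply: (@leq_card_rel _ _ _ _ (fun x u => [exists i, (x \in tail t i) && (u \in P i)])).
  move=> x Dx; have [i tail_x] := in_tail x Dx.
  have := Dx; rewrite inE => /andP[tx t'x].
  have [u Pu t'u] := LambdaP _ t'L i.
  have tail_u : u \notin tail t i.
    apply: contra t'u => tail_u; case: (boolP (u \in t)) => tu.
      by apply: sRt'; apply/restrP; split=> //; left; exists i.
    have : u \in tail t i :\: t by rewrite inE tu.
    by rewrite (tail_missingE tL tail_x tx) inE => /eqP->.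
  have lt_ux : rk u < rk x.
    rewrite ltnNge; apply: contra tail_u => le_xu.
    exact: (tail_upclosed tail_x).
  exists u; last by apply/existsP; exists i; rewrite tail_x.
  have tu : u \in t.
    apply: contraT => tu; case/negP: restr_z; apply/restrP; split=> //; right.
    exists u; last exact: ltn_trans lt_ux (lt_z x Dx).
    rewrite inE tu; apply/poolP=> j; apply: contra tail_u => tail_u.
    by rewrite (P_index Pu (subsetP (tail_subset t j) u tail_u)).
  rewrite !inE tu t'u !andbT; apply: contraNneq restr_z => eq_uz.
  by apply/restrP; split=> //; left; exists i; apply: (tail_upclosed tail_x);
     [rewrite -eq_uz | apply/ltnW/lt_z].
move=> x x' Dx Dx' u /existsP[i /andP[tail_x Pu]] /existsP[j /andP[tail_x' Pu']].
move: tail_x'; rewrite -(P_index Pu Pu') => tail_x'.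
move: Dx Dx'; rewrite !inE => /andP[tx _] /andP[tx' _].
have : x' \in tail t i :\: t by rewrite inE tx'.
by rewrite (tail_missingE tL tail_x tx) inE => /eqP.
Qed.

(** A face with fewer than [d] elements has a gap by [card_gaps], and adding it gives a face, since
    each [P i] still misses its last missing element. *)
Lemma facets_skel_Lambda d t :
  d + m <= #|V| -> (t \in facets (skel d (Lambda P))) = (t \in Lambda P) && (#|t| == d).
Proof.
move=> le_dm; rewrite inE; apply/maxsetP/andP => [[]|[tL /eqP card_t]]; last first.
  split=> [|B]; first by rewrite inE tL card_t leqnn.
  rewrite inE => /andP[_ le_Bd] stB; apply/esym/eqP.
  by rewrite eqEcard stB card_t.
rewrite inE => /andP[tL le_td] t_max; split=> //; rewrite eqn_leq le_td leqNgt /=.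
apply/negP=> lt_td; have := card_gaps tL => card_t.
have [x]: exists x, x \in gaps t by apply/card_gt0P; lia.
rewrite in_setD => /andP[tx /poolP pool_x].
suff xtL : x |: t \in Lambda P.
  have := t_max (x |: t); rewrite inE xtL cardsU1 tx => /(_ lt_td (subsetUr _ _)) eqt.
  by rewrite -eqt setU11 in tx.
apply/LambdaP=> i; have [w [Pw tw tailE]] := last_missing i tL.
exists w => //; rewrite !inE negb_or tw andbT.
by apply: contraNneq (pool_x i) => <-; rewrite tailE.
Qed.

Lemma eq_tail t t' i : {in P i, t =i t'} -> tail t i = tail t' i.
Proof.
move=> eq_t; apply/setP=> y; apply/tailP/tailP => -[Py in_t]; split=> // z Pz lt_yz.
  by rewrite -eq_t //; apply: in_t.
by rewrite eq_t //; apply: in_t.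
Qed.

Lemma revlex_rshift r t t' i :
    #|tail t' i|.-1 < #|tail t i|.-1 ->
    (forall j : 'I_m, i < j -> tail t' j = tail t j) ->
  revlex_lt (sigma r t') (sigma r t).
Proof.
move=> lt_i eq_above; exists (rshift r i); split; first by rewrite !sigma_rshift.
move=> j; rewrite -(splitK j); case: (split j) => [j'|j'] /= lt_ij.
  by have := ltn_ord j'; lia.
by rewrite !sigma_rshift eq_above //; lia.
Qed.

Lemma revlex_lshift r t t' (k : 'I_r) :
    gap_count rk (pool t') (gaps t') k < gap_count rk (pool t) (gaps t) k ->
    (forall j, k < j ->
       gap_count rk (pool t') (gaps t') j = gap_count rk (pool t) (gaps t) j) ->
    tail t' =1 tail t ->
  revlex_lt (sigma r t') (sigma r t).
Proof.
move=> lt_k eq_above eq_tails; exists (lshift m k); split; first by rewrite !sigma_lshift.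
move=> j; rewrite -(splitK j); case: (split j) => [j'|j'] /= lt_kj.
  by rewrite !sigma_lshift eq_above.
by rewrite !sigma_rshift eq_tails.
Qed.

(** * Exchanging an element of the restriction for an earlier missing one *)

Definition exchange t x y := x |: t :\ y.

Lemma exchangeE t x y v : (v \in exchange t x y) = (v == x) || (v != y) && (v \in t).
Proof. by rewrite !inE. Qed.

Lemma card_exchange t x y : x \notin t -> y \in t -> #|exchange t x y| = #|t|.
Proof.
by move=> tx ty; rewrite cardsU1 (cardsD1 y t) ty !inE (negPf tx) andbF.
Qed.

(** If no tail grows and no gap appears before the first one, an element other than [x] can be in
    the new restriction only if it was in the old one. *)
Lemma restr_exchange t x y :
    x \notin t -> rk x < rk y ->
    (forall i, tail (exchange t x y) i \subset tail t i) ->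
    {in gaps (exchange t x y), forall z, exists2 z0, z0 \in gaps t & rk z0 <= rk z} ->
  restr (exchange t x y) \subset x |: restr t :\ y.
Proof.
move=> tx lt_xy sub_tail sub_gaps; apply/subsetP=> v /restrP[].
rewrite exchangeE in_setU1 in_setD1; case: (v == x) => //= /andP[-> tv] /= Rv.
apply/restrP; split=> //; case: Rv => [[i tail_v]|[z Gz lt_zv]].
  by left; exists i; apply: (subsetP (sub_tail i)).
right; have [z0 Gz0 le_z0] := sub_gaps z Gz; exists z0 => //.
exact: leq_ltn_trans lt_zv.
Qed.

(** Take for [x] the last element of [P i] missing from [t]. After the exchange [y] is the last
    missing one, so this tail shrinks, the other tails stay and no gap is created. *)
Lemma exchange_tail t y i : t \in Lambda P -> y \in t -> y \in tail t i ->
  exists x, [/\ x \notin t, rk x < rk y, exchange t x y \in Lambda P,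
    restr (exchange t x y) \subset x |: restr t :\ y &
    forall r, revlex_lt (sigma r (exchange t x y)) (sigma r t)].
Proof.
move=> tL ty tail_y; have Py := subsetP (tail_subset t i) y tail_y.
have [x [Px tx tailE]] := last_missing i tL.
have ne_xy : x != y by apply: contraNneq tx => ->.
have lt_xy : rk x < rk y.
  by rewrite ltn_neqAle -tailE // tail_y andbT; apply: contra ne_xy => /eqP/rk_inj->.
have tail_x : x \in tail t i by rewrite tailE.
pose t' := exchange t x y.
have t'y : y \notin t' by rewrite exchangeE eqxx eq_sym (negPf ne_xy).
have t'x : x \in t' by rewrite exchangeE eqxx.
have eq_t' j : j != i -> {in P j, t' =i t}.
  move=> ne_ji v Pv; rewrite exchangeE.
  have notP u : u \in P i -> v != u.
    move=> Pu; apply: contraNneq ne_ji => eq_v.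
    by rewrite (P_index Pu (j := j)) // -eq_v.
  by rewrite (negPf (notP x Px)) (notP y Py).
have eq_tail' j : j != i -> tail t' j = tail t j by move/eq_t'/eq_tail.
have t'L : t' \in Lambda P.
  apply/LambdaP=> j; have [->|ne_ji] := eqVneq j i; first by exists y.
  by have [z Pz tz] := LambdaP _ tL j; exists z; rewrite // (eq_t' j ne_ji z Pz).
have sub_tail : tail t' i \subset tail t i.
  apply/subsetP=> v /tailP[Pv in_t']; apply: (tail_upclosed tail_y) => //.
  by rewrite leqNgt; apply: contra t'y => lt_vy; apply: in_t'.
exists x; split=> //; first apply: restr_exchange => // [j|z].
- by have [->//|ne_ji] := eqVneq j i; rewrite eq_tail'.
- rewrite in_setD -/t' => /andP[t'z /poolP pool_z]; exists z => //.
  have ne_zy : z != y.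
    apply: contraNneq (pool_z i) => ->; apply/tailP; split=> // u Pu lt_yu.
    have /tailP[_ in_t] := tail_y; rewrite exchangeE in_t // andbT.
    by case: (eqVneq u y) lt_yu => [->|]; rewrite ?ltnn ?orbT.
  have tz : z \notin t by move: t'z; rewrite exchangeE ne_zy negb_or => /andP[].
  rewrite in_setD tz; apply/poolP=> j; have [->|ne_ji] := eqVneq j i; last first.
    by rewrite -eq_tail'.
  apply/negP=> tail_z; have : z \in tail t i :\: t by rewrite inE tz.
  rewrite (tail_missingE tL tail_x tx) inE => /eqP eq_zx.
  by rewrite eq_zx t'x in t'z.
move=> r; apply: (@revlex_rshift _ _ _ i) => [|j lt_ij]; last first.
  by apply: eq_tail'; apply: contraTneq lt_ij => ->; rewrite ltnn.
have : #|tail t' i| < #|tail t i|.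
  apply: proper_card; apply/properP; split=> //; exists x => //.
  by apply: contra t'y => /tailP[_]; apply.
have := card_tail_gt0 i t'L; rewrite -/t'; lia.
Qed.

(** Neither [x] nor [y] lies in a tail, so tails and pool are unchanged; the gap at [x] moves up to
    [y], and [gap_count_revlex] compares the counts. *)
Lemma exchange_gap t x y : t \in Lambda P -> y \in t -> y \in pool t ->
    x \in gaps t -> rk x < rk y ->
  [/\ exchange t x y \in Lambda P,
      restr (exchange t x y) \subset x |: restr t :\ y &
      forall r, #|gaps t| = r -> revlex_lt (sigma r (exchange t x y)) (sigma r t)].
Proof.
move=> tL ty pool_y Gx lt_xy; have := Gx; rewrite in_setD => /andP[tx pool_x].
have ne_yx : y != x by apply: contraTneq lt_xy => ->; rewrite ltnn.
pose t' := exchange t x y.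
have t'y : y \notin t' by rewrite exchangeE eqxx (negPf ne_yx).
have tail_x j : x \notin tail t j by move/poolP: pool_x; apply.
have tail_y j : y \notin tail t j by move/poolP: pool_y; apply.
have tail_t' j : tail t' j = tail t j.
  have [w [Pw tw tailE]] := last_missing j tL.
  have ne_wx : w != x by apply: contraNneq (tail_x j) => <-; rewrite tailE.
  apply/setP=> v; apply/tailP/tailP => -[Pv in_t]; split=> // u Pu lt_vu.
    have := in_t u Pu lt_vu; rewrite exchangeE => /orP[/eqP eq_ux|/andP[]//].
    have lt_uw : rk u < rk w by rewrite ltnNge -tailE // eq_ux.
    have := in_t w Pw (ltn_trans lt_vu lt_uw).
    by rewrite exchangeE (negPf ne_wx) (negPf tw) andbF.
  rewrite exchangeE in_t // andbT; apply/orP; right.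
  apply: contraNneq (tail_y j) => eq_uy.
  apply/tailP; rewrite -eq_uy; split=> // z Pz lt_uz.
  by apply: in_t => //; apply: ltn_trans lt_uz.
have pool_t' : pool t' = pool t by congr (~: _); apply: eq_bigr.
have gapsE v : (v \in gaps t') = (v == y) || (v != x) && (v \in gaps t).
  rewrite !in_setD pool_t' exchangeE.
  have [->|_] := eqVneq v y; first by rewrite pool_y (negPf ne_yx).
  by rewrite /= negb_or andbA.
split.
- apply/LambdaP=> j; have [w [Pw tw tailE]] := last_missing j tL.
  exists w => //; rewrite exchangeE (negPf tw) andbF orbF.
  by apply: contraNneq (tail_x j) => <-; rewrite tailE.
- apply: restr_exchange => // [j|z]; first by rewrite tail_t'.
  rewrite gapsE => /predU1P[->|/andP[_ Gz]]; last by exists z.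
  by exists x => //; apply: ltnW.
move=> r card_G.
have G'y : y \in gaps t' by rewrite gapsE eqxx.
have Gy : y \notin gaps t by rewrite in_setD ty.
have eq_card : #|gaps t| = #|gaps t'|.
  have -> : gaps t' = y |: gaps t :\ x by apply/setP=> v; rewrite gapsE !inE.
  by rewrite cardsU1 (cardsD1 x (gaps t)) Gx !inE ty andbF.
have agree v : rk y < rk v -> (v \in gaps t') = (v \in gaps t).
  move=> lt_yv; rewrite gapsE.
  have [eq_vy|_] := eqVneq v y; first by rewrite eq_vy ltnn in lt_yv.
  by have [eq_vx|//] := eqVneq v x; move: lt_yv; rewrite eq_vx; lia.
have [k [lt_k lt_count eq_count]] := gap_count_revlex rk_inj eq_card pool_y G'y Gy agree.
rewrite -eq_card card_G in lt_k.
by apply: (@revlex_lshift r t t' (Ordinal lt_k)); rewrite ?pool_t'.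
Qed.

Lemma restr_exchange_exists t y : t \in Lambda P -> y \in restr t ->
  exists x, [/\ x \notin t, rk x < rk y, exchange t x y \in Lambda P,
    restr (exchange t x y) \subset x |: restr t :\ y &
    forall r, #|gaps t| = r -> revlex_lt (sigma r (exchange t x y)) (sigma r t)].
Proof.
move=> tL Ry; have /restrP[ty Ry'] := Ry.
case: (boolP (y \in pool t)) => [pool_y|].
  case: Ry' => [[i]|[x Gx lt_xy]].
    by move/poolP: pool_y => /(_ i)/negPf->.
  have [? ? ?] := exchange_gap tL ty pool_y Gx lt_xy; exists x; split=> //.
  by move: Gx; rewrite in_setD => /andP[].
rewrite poolE negbK => /bigcupP[i _ tail_y].
by have [x [? ? ? ? ltS]] := exchange_tail tL ty tail_y; exists x.
Qed.

(** The construction of [sigma] is reversed: prescribe the tails as final segments [T i], then the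
    gaps [G] in the remaining pool [W]; [t] is everything except [G] and the first elements of the
    [T i]. *)
Lemma sigma_surj r d (p : 'I_m -> nat) (c : 'X_{1..r + m}) :
    (forall i, #|P i| = p i) -> (forall i, 0 < p i) -> #|V| = r + m + d ->
    c \in Smon_deg (bounds r p) d ->
  exists t, [/\ t \in Lambda P, #|t| = d & sigma r t = c].
Proof.
move=> card_P p_gt0 card_V /andP[/forallP c_le]; rewrite mdegE big_split_ord /= => deg_c.
have c_ltP i : c (rshift r i) < #|P i|.
  have := c_le (rshift r i); rewrite /bounds (unsplitK (inr i)) card_P.
  by have := p_gt0 i; lia.
(* The size is one more than the exponent, to make room for the missing element [w i]. *)
have /fin_all_exists[T TP] i : exists T : {set V},
    [/\ T \subset P i, #|T| = (c (rshift r i)).+1 & upclosed_in rk (P i) T].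
  by have [B [sBP cardB] upB] := upclosed_in_exists rk_inj (c_ltP i); exists B.
have /fin_all_exists[w wP] i : exists w : V,
    w \in T i /\ forall v, v \in T i -> rk w <= rk v.
  have [_ cardT _] := TP i.
  have [x0 Tx0] : exists x, x \in T i by apply/card_gt0P; rewrite cardT.
  by case: (@arg_minnP _ x0 (fun x => x \in T i) rk Tx0) => x Tx x_min; exists x.
pose W := ~: \bigcup_i T i.
have sTP i : T i \subset P i by case: (TP i).
(* [e] is the sum of the last [m] exponents; the pool then has [r + (d - e)] elements, as
   [gap_count_surj] asks. *)
have [e [le_d card_W]] : exists e,
    \sum_j c (lshift m j) + e <= d /\ #|W| + (e + m) = r + m + d.
  exists (\sum_i c (rshift r i)); split=> //.
  rewrite -card_V -(cardsC W) setCK (card_bigcup_P) //; congr (_ + _).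
  rewrite -[X in _ + X = _]card_ord -sum1_card -big_split /=.
  by apply: eq_bigr => i _; rewrite addn1; case: (TP i).
have [G [sGW card_G] countG] :
    exists2 G : {set V}, G \subset W /\ #|G| = r &
      forall j : 'I_r, gap_count rk W G j = c (lshift m j).
  apply: (@gap_count_surj _ rk rk_inj W r (d - e)); lia.
pose t := ~: (G :|: [set w i | i : 'I_m]).
have G_T i v : v \in T i -> v \notin G.
  move=> Tv; apply/negP=> /(subsetP sGW); rewrite inE => /bigcupP[].
  by exists i.
have tw i : w i \notin t.
  by rewrite !inE negbK (imset_f w) ?orbT.
have t_T i v : v \in T i -> v != w i -> v \in t.
  move=> Tv ne_v; rewrite !inE (negPf (G_T i v Tv)) /=; apply/imsetP=> -[j _ eq_v].
  have [Tw _] := wP j; move: ne_v; rewrite eq_v.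
  by rewrite (P_index (i := i) (j := j) (y := v)) ?eqxx //;
     [exact: (subsetP (sTP i)) | rewrite eq_v; exact: (subsetP (sTP j))].
have tail_t i : tail t i = T i.
  have [_ _ upT] := TP i; have [Tw w_min] := wP i.
  apply/setP=> v; apply/tailP/idP => [[Pv in_t]|Tv].
    apply: (upT (w i)) => //; rewrite leqNgt; apply: contra (tw i) => lt_vw.
    by apply: in_t => //; apply: (subsetP (sTP i)).
  split=> [|z Pz lt_vz]; first exact: (subsetP (sTP i)).
  apply: (t_T i); first exact: (upT v) (ltnW lt_vz).
  by apply: contraTneq lt_vz => ->; rewrite -leqNgt w_min.
have pool_t : pool t = W by congr (~: _); apply: eq_bigr.
have gaps_t : gaps t = G.
  apply/setP=> v; rewrite in_setD pool_t !inE negbK; apply/andP/idP => [[]|Gv].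
    case/orP=> // /imsetP[i _ ->] /bigcupP[]; exists i => //; by case: (wP i).
  by rewrite Gv; have := subsetP sGW v Gv; rewrite inE.
have tL : t \in Lambda P.
  by apply/LambdaP=> i; exists (w i); rewrite ?tw // (subsetP (sTP i)) //; case: (wP i).
exists t; split=> //.
  by have := card_gaps tL; rewrite gaps_t card_G card_V; lia.
apply/mnmP=> j; rewrite -(splitK j); case: (split j) => j' /=.
  by rewrite sigma_lshift pool_t gaps_t countG.
by rewrite sigma_rshift tail_t; case: (TP j') => _ ->.
Qed.

End Facets.

(** * The restriction sets R_O *)

Lemma ohead_filterP (T : eqType) (a : pred T) (s : seq T) :
  if ohead [seq x <- s | a x] is Some x
  then a x /\ {in s, forall z, a z -> index x s <= index z s}
  else {in s, forall z, ~~ a z}.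
Proof.
elim: s => //= y s; case: ifP => [ay _|a'y]; first by split; rewrite //= eqxx.
case: ohead => [x [ax x_min]|no_a]; last first.
  by move=> z; rewrite inE => /predU1P[->|/no_a//]; rewrite a'y.
split=> // z; rewrite inE => /predU1P[->|sz] az; first by rewrite az in a'y.
have -> : (y == x) = false by apply: contraTF ax => /eqP<-; rewrite a'y.
have -> : (y == z) = false by apply: contraTF az => /eqP<-; rewrite a'y.
exact: x_min.
Qed.

Section RestrictionSets.
Variables (V : finType) (m : nat) (P : 'I_m -> {set V}) (O : seq V).
Hypothesis O_all : forall y, y \in O.
Hypothesis disj_P : forall i j, i != j -> [disjoint P i & P j].
Implicit Types t : {set V}.
Let rk y := index y O.

Let rk_inj : injective rk.
Proof. by move=> x y; apply: (index_inj x). Qed.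

Lemma missP t i x : i \in full P t ->
  (miss P t i == Some x) = (x \in P i) && (x \notin t).
Proof.
rewrite inE -(cardsID t (P i)) -addn1 eqn_add2l eq_sym => /cards1P[w PtE].
have inPt y : (y \in P i) && (y \notin t) = (y == w).
  by rewrite andbC -in_setD PtE inE.
rewrite inPt /miss; case: pickP => [y|/(_ w)]; last by rewrite PtE inE eqxx.
by rewrite PtE inE => /eqP->; rewrite eq_sym.
Qed.

Lemma missingP t x :
  reflect (exists i, [/\ i \in full P t, x \in P i & x \notin t]) (x \in missing P t).
Proof.
rewrite inE; apply: (iffP existsP) => -[i].
  by case/andP=> full_i; rewrite missP // => /andP[]; exists i.
by case=> full_i Px tx; exists i; rewrite full_i missP // Px.
Qed.

Lemma full_missing_tail t i x :
  i \in full P t -> x \in P i -> x \notin t -> x \in tail P rk t i.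
Proof.
move=> full_i Px tx; apply/tailP; split=> // z Pz lt_xz; apply: contraT => tz.
have /eqP miss_x : miss P t i == Some x by rewrite missP ?Px.
have : miss P t i == Some z by rewrite missP ?Pz.
by rewrite miss_x => /eqP[eq_xz]; rewrite eq_xz ltnn in lt_xz.
Qed.

(** [P i] misses a second element besides [x]; it is outside the tail, hence before [x], in the pool
    and a gap. *)
Lemma not_full_gap t i x : t \in Lambda P -> i \notin full P t ->
    x \in tail P rk t i -> x \notin t ->
  exists2 z, z \in gaps P rk t & rk z < rk x.
Proof.
move=> tL not_full tail_x tx; have Px := subsetP (tail_subset P rk t i) x tail_x.
have [z]: exists z, z \in (P i :\: t) :\ x.
  apply/set0Pn; apply: contra not_full => /eqP PtE.
  rewrite inE -(cardsID t (P i)) -addn1 eqn_add2l (cardsD1 x) PtE cards0.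
  by rewrite inE tx Px.
rewrite !inE => /and3P[ne_zx tz Pz].
have tail_z : z \notin tail P rk t i.
  apply: contra ne_zx => tail_z; have : z \in tail P rk t i :\: t by rewrite inE tz.
  by rewrite (tail_missingE rk_inj tL tail_x tx) inE.
exists z; last first.
  by rewrite ltnNge; apply: contra tail_z; apply: (tail_upclosed tail_x).
rewrite in_setD tz; apply/poolP=> j; apply: contra tail_z => tail_z.
by rewrite (P_index disj_P Pz (subsetP (tail_subset P rk t j) z tail_z)).
Qed.

(** For full [i] the part of [P i] beyond its missing element is in [U_O]; for other [i] the part
    beyond the last missing element lies beyond a gap, by [not_full_gap]. By the same lemma anything
    beyond [s_O] is beyond a gap; conversely, every gap is a candidate for [s_O]. *)
Lemma R_O_restr t : t \in Lambda P -> R_O P O t = restr P rk t.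
Proof.
move=> tL; apply/setP=> y.
have := ohead_filterP (fun x => (x \notin missing P t) && (x \notin t)) O.
rewrite -/(s_O P O t) in_setU inE => s_min.
have gap_R : y \in t -> (exists2 z, z \in gaps P rk t & rk z < rk y) -> gtO O y (s_O P O t).
  move=> ty [z]; rewrite in_setD => /andP[tz /poolP pool_z] lt_zy.
  have z_free : (z \notin missing P t) && (z \notin t).
    rewrite tz andbT; apply/missingP=> -[i [full_i Pz _]].
    by have := pool_z i; rewrite full_missing_tail.
  case: (s_O P O t) s_min => [x [_ x_min]|none]; last first.
    by have := none z (O_all z); rewrite z_free.
  exact: leq_ltn_trans (x_min z (O_all z) z_free) lt_zy.
apply/orP/restrP => [[/andP[ty]|]|[ty [[i tail_y]|gap_y]]].
- case: (s_O P O t) s_min => //= x [/andP[x_free tx] _] lt_xy; split=> //; right.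
  case: (boolP (x \in pool P rk t)) => [pool_x|].
    by exists x => //; rewrite in_setD tx.
  rewrite poolE negbK => /bigcupP[i _ tail_x].
  have [|z Gz lt_zx] := not_full_gap tL _ tail_x tx.
    apply: contra x_free => full_i; apply/missingP; exists i; split=> //.
    exact: (subsetP (tail_subset P rk t i)).
  by exists z => //; apply: ltn_trans lt_xy.
- rewrite inE => /existsP[i /and3P[full_i Py]].
  have [w Pw tw] := LambdaP _ _ tL i.
  have /eqP -> : miss P t i == Some w by rewrite missP ?Pw.
  move=> /= lt_wy.
  have tail_w := full_missing_tail full_i Pw tw.
  split; last by left; exists i; apply: (tail_upclosed tail_w) => //; apply: ltnW.
  by case/tailP: tail_w => _; apply.
- have Py := subsetP (tail_subset P rk t i) y tail_y.
  have [w [Pw tw tailE]] := last_missing rk i tL.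
  have lt_wy : rk w < rk y.
    rewrite ltn_neqAle -tailE // tail_y andbT.
    by apply: contraNneq tw => /rk_inj->.
  case: (boolP (i \in full P t)) => [full_i|not_full].
    right; rewrite inE; apply/existsP; exists i; rewrite full_i Py /=.
    by have /eqP -> : miss P t i == Some w by rewrite missP ?Pw.
  left; rewrite ty gap_R //.
  have [|z Gz lt_zw] := not_full_gap tL not_full _ tw; first by rewrite tailE.
  by exists z => //; apply: ltn_trans lt_wy.
by left; rewrite ty gap_R.
Qed.

End RestrictionSets.

(** * The shelling *)

(** The old faces of the facet are those omitting some [y] of [R], and the largest such are the sets
    [tnth L i :\ y]. *)
Lemma T_L_restriction (V : finType) s (L : s.-tuple {set V}) (i : 'I_s) (R : {set V}) :
    R \subset tnth L i ->
    powerset (tnth L i) :\: before L i =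
      [set gamma : {set V} | (gamma \subset tnth L i) && (R \subset gamma)] ->
  T_L L i = [set tnth L i :\ y | y in R].
Proof.
set t := tnth L i => sRt new_faces.
have oldE gamma : (gamma \in powerset t :&: before L i) =
    (gamma \subset t) && ~~ (R \subset gamma).
  have := congr1 (fun K : {set {set V}} => gamma \in K) new_faces.
  rewrite !inE; case: (gamma \subset t) => //=.
  by rewrite ?andbT ?andbF => <-; rewrite negbK.
apply/setP=> gamma; rewrite inE; apply/maxsetP/imsetP => [[]|[y Ry ->]].
  rewrite oldE => /andP[sgt /subsetPn[y Ry g'y]] g_max; exists y => //.
  apply/esym/g_max; last by rewrite subsetD1 sgt.
  by rewrite oldE subD1set; apply/subsetPn; exists y; rewrite // !inE eqxx.
split=> [|B].
  by rewrite oldE subD1set; apply/subsetPn; exists y; rewrite // !inE eqxx.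
rewrite oldE => /andP[sBt /subsetPn[z Rz B'z]] sB.
have eq_zy : z = y.
  apply/eqP; apply: contraNT B'z => ne_zy.
  by rewrite (subsetP sB) // !inE ne_zy (subsetP sRt).
by apply/eqP; rewrite eqEsubset sB subsetD1 sBt -eq_zy B'z.
Qed.

Lemma card_setD1_imset (V : finType) (t R : {set V}) :
  R \subset t -> #|[set t :\ y | y in R]| = #|R|.
Proof.
move=> /subsetP sRt; apply: card_in_imset => x y Rx Ry /setP/(_ x).
by rewrite !inE eqxx sRt //= andbT => /esym/negbFE/eqP.
Qed.

Theorem theorem4p1 (l m n d : nat) (p : 'I_m -> nat)
    (V : finType) (V' : {set V}) (P : 'I_m -> {set V}) (O : n.-tuple V)
    (p_ge1 : forall i, 1 <= p i)
    (p_noninc : forall i j : 'I_m, i <= j -> p j <= p i)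
    (card_V : #|V| = n) (card_V' : #|V'| = l) (card_P : forall i, #|P i| = p i)
    (cover_V : V' :|: \bigcup_i P i = [set: V])
    (disj_V'P : forall i, [disjoint V' & P i])
    (disj_PP : forall i j, i != j -> [disjoint P i & P j])
    (O_uniq : uniq O)
    (O_last : forall (i : 'I_m) (k : 'I_n), k = n - m + i :> nat ->
       tnth O k \in P i)
    (d_ge1 : 1 <= d) (d_le : d <= n - m) :
  let K := skel d (Lambda P) in
  let a := bounds (n - d - m) p in
  exists (t : nat) (L : t.-tuple {set V})
         (sigma : {set V} -> 'X_{1..(n - d - m) + m}),
    [/\ is_shelling K L,
        bijection_between (facets K) (Smon_deg a d) sigma &
        forall i : 'I_t,
          [/\ powerset (tnth L i) :\: before L i =
                [set gamma : {set V} |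
                   (gamma \subset tnth L i) && (R_O P O (tnth L i) \subset gamma)],
              mdeg (sigma (tnth L i)) = #|T_L L i| &
              forall gamma, gamma \in T_L L i ->
                exists (j : 'I_t) (mu : 'X_{1..(n - d - m) + m}),
                  [/\ j < i,
                      (mu <= sigma (tnth L i))%MM,
                      gamma \subset tnth L j,
                      mdeg mu = mdeg (sigma (tnth L j)) &
                      revlex_le (sigma (tnth L j)) mu]]].
Proof.
move=> K a; set r := n - d - m in a *.
have O_all y : y \in O.
  apply: contraT => Oy; have : #|y :: O| <= #|V| by apply: max_card.
  by rewrite (card_uniqP _) /= ?Oy // size_tuple card_V ltnn.
pose rk (y : V) := index y O.
have rk_inj : injective rk by move=> x y; apply: (index_inj x).
(* [1 <= d <= n - m] makes the truncated subtractions in [r] exact. *)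
have n_eq : #|V| = r + m + d by rewrite card_V /r; lia.
have facetE t : (t \in facets K) = (t \in Lambda P) && (#|t| == d).
  by apply: (facets_skel_Lambda rk_inj disj_PP); lia.
have card_G t : t \in facets K -> #|gaps P rk t| = r.
  rewrite facetE => /andP[tL /eqP card_t].
  by have := card_gaps rk_inj disj_PP tL; lia.
have deg_sigma t : t \in facets K -> mdeg (sigma P rk r t) = #|restr P rk t|.
  move=> Kt; apply: mdeg_sigma => //; last exact: card_G.
  by move: Kt; rewrite facetE => /andP[].
pose leK := relpre (key rk) leq.
pose L := in_tuple (sort leK (enum (facets K))).
have LE t : (t \in L) = (t \in facets K) by rewrite mem_sort mem_enum.
have L_uniq : uniq L by rewrite sort_uniq enum_uniq.
have L_facet i : tnth L i \in facets K by rewrite -LE mem_tnth.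
have L_face i : tnth L i \in Lambda P by have := L_facet i; rewrite facetE => /andP[].
have L_card i : #|tnth L i| = d by have := L_facet i; rewrite facetE => /andP[_ /eqP].
have leK_refl : reflexive leK by move=> x; apply: leqnn.
have leK_trans : transitive leK by move=> x y z; apply: leq_trans.
have L_sorted : sorted leK L by apply: sort_sorted => x y; apply: leq_total.
have key_le (i j : 'I_(size L)) : i <= j -> key rk (tnth L i) <= key rk (tnth L j).
  move=> le_ij; rewrite !(tnth_nth set0).
  by apply: (sorted_leq_nth leK_trans leK_refl set0 L_sorted); rewrite ?inE.
have earlier t i : t \in facets K -> key rk t < key rk (tnth L i) ->
    exists2 j : 'I_(size L), j < i & tnth L j = t.
  rewrite -LE => /tnthP[j ->] lt_key; exists j => //.
  by rewrite ltnNge; apply: contraL lt_key => /key_le; rewrite leqNgt.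
(* Exchanging [y] lowers the key, so the resulting facet stands earlier; its restriction loses [y]
   and gains at most [x]. *)
have exchangeP i y : y \in restr P rk (tnth L i) -> exists2 j : 'I_(size L),
    j < i & [/\ tnth L i :\ y \subset tnth L j,
                #|restr P rk (tnth L j)| <= #|restr P rk (tnth L i)| &
                revlex_lt (sigma P rk r (tnth L j)) (sigma P rk r (tnth L i))].
  move=> Ry; have [x [tx lt_xy t'L sRR lt_sigma]] :=
    restr_exchange_exists rk_inj disj_PP (L_face i) Ry.
  have /restrP[ty _] := Ry.
  have Kt' : exchange (tnth L i) x y \in facets K.
    by rewrite facetE t'L card_exchange // L_card eqxx.
  have [j lt_ji Lj] := earlier _ i Kt' (key_exchange rk_inj ty tx lt_xy).
  exists j => //; rewrite Lj; split; [exact: subsetUr | | exact/lt_sigma/card_G].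
  have := subset_leq_card sRR; rewrite cardsU1 (cardsD1 y (restr _ _ (tnth L i))) Ry.
  by move/leq_trans; apply; rewrite leq_add2r leq_b1.
have sRt t : restr P rk t \subset t by apply: subsetIl.
have new_faces i : powerset (tnth L i) :\: before L i =
    [set gamma : {set V} |
      (gamma \subset tnth L i) && (restr P rk (tnth L i) \subset gamma)].
  apply/setP=> gamma; rewrite in_setD powersetE inE andbC.
  case: (boolP (gamma \subset _)) => //= sgt.
  (* A face omitting some [y] of the restriction lies in the facet obtained by exchanging [y]; one
     containing the restriction lies in no earlier facet, by [key_restr_lt]. *)
  apply/idP/idP => [|sRg].
    apply: contraNT => /subsetPn[y Ry g'y]; have [j lt_ji [sub_j _ _]] := exchangeP i y Ry.
    apply/bigcupP; exists j => //; rewrite powersetE; apply: subset_trans sub_j.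
    by rewrite subsetD1 sgt.
  apply/bigcupP=> -[j lt_ji]; rewrite powersetE => sgj.
  have : key rk (tnth L i) < key rk (tnth L j).
    apply: (key_restr_lt rk_inj disj_PP) => //; rewrite ?L_card //.
      exact: subset_trans sgj.
    by apply: contraTneq lt_ji => /(tuple_uniqP _ L_uniq) ->; rewrite ltnn.
  by rewrite ltnNge key_le // ltnW.
have T_LE i : T_L L i = [set tnth L i :\ y | y in restr P rk (tnth L i)].
  exact: T_L_restriction (new_faces i).
exists (size L), L, (sigma P rk r); split.
- split=> [|i gamma]; first by split.
  rewrite T_LE => /imsetP[y Ry ->].
  by rewrite [RHS](cardsD1 y) (subsetP (sRt _) y Ry).
- split=> [t Kt|t t' Kt Kt'|c Sc].
  + rewrite unfold_in deg_sigma //; apply/andP; split; last first.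
      by have := Kt; rewrite facetE => /andP[_ /eqP<-]; apply: subset_leq_card.
    apply/forallP=> j; rewrite /a /bounds -{2}(splitK j); case: (split j) => //= j'.
    rewrite sigma_rshift -card_P.
    by have := subset_leq_card (tail_subset P rk t j'); lia.
  + move: (Kt) (Kt'); rewrite !facetE => /andP[tL _] /andP[t'L _].
    by apply: (sigma_inj rk_inj); rewrite ?card_G.
  have [t [tL card_t eq_c]] := sigma_surj rk_inj disj_PP card_P p_ge1 n_eq Sc.
  by exists t; rewrite // facetE tL card_t eqxx.
move=> i; split=> [||gamma].
- by rewrite R_O_restr.
- by rewrite deg_sigma // T_LE card_setD1_imset.
rewrite T_LE => /imsetP[y Ry ->].
(* [gamma] omits a single [y] of the restriction; exchanging [y] gives [j], and [le_R] is the degree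
   bound that [revlex_lt_divisor] requires. *)
have [j lt_ji [sub_j le_R lt_sigma]] := exchangeP i y Ry.
have [|mu [le_mu deg_mu le_sigma]] := revlex_lt_divisor lt_sigma.
  by rewrite !deg_sigma.
by exists j, mu.
Qed.
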